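(* Let $F$ be a positive integer and let $S\in\mathrm{Arf}(F)$. Then $X=\{x\in\mathrm{msg}(S)\mid S\setminus\{x\}\in\mathrm{Arf}(F)\}$ is the unique minimal $\mathrm{Arf}(F)$-system of generators of $S$.
   Context: $\mathbb{N}$ denotes the set of nonnegative integers. A numerical semigroup is a subset $S\subseteq\mathbb{N}$ that contains $0$, is closed under addition, and has finite complement in $\mathbb{N}$. The Frobenius number $\mathrm{F}(S)$ is the greatest integer not in $S$. Every numerical semigroup $S$ has a unique minimal system of generators, denoted $\mathrm{msg}(S)$. An A-semigroup (Arf numerical semigroup) is a numerical semigroup $S$ such that $x+y-z\in S$ for all $x,y,z\in S$ with $x\ge y\ge z$. $\mathrm{Arf}(F)$ is the set of A-semigroups with Frobenius number $F$; its minimum with respect to inclusion is $\Delta(F)=\{0\}\cup\{n\in\mathbb{N}\mid n\ge F+1\}$. A set $X$ is an $\mathrm{Arf}(F)$-set if $X\cap\Delta(F)=\emptyset$ and there is $S\in\mathrm{Arf}(F)$ such that $X\subseteq S$. For an $\mathrm{Arf}(F)$-set $X$, $\mathrm{Arf}(F)[X]$ denotes the intersection of all elements of $\mathrm{Arf}(F)$ containing $X$ (it is the smallest element of $\mathrm{Arf}(F)$ containing $X$). If $X$ is an $\mathrm{Arf}(F)$-set and $S=\mathrm{Arf}(F)[X]$, then $X$ is called an $\mathrm{Arf}(F)$-system of generators of $S$; it is minimal if moreover $S\neq\mathrm{Arf}(F)[Y]$ for all $Y\subsetneq X$. *)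

(* Defs.v *)
From mathcomp Require Import all_boot.
From mathcomp Require Import boolp classical_sets cardinality.

Set Implicit Arguments.
Unset Strict Implicit.
Unset Printing Implicit Defensive.

Local Open Scope classical_set_scope.

Definition submonoid (M : set nat) : Prop :=
  M 0 /\ forall x y, M x -> M y -> M (x + y).

Definition numerical_semigroup (S : set nat) : Prop :=
  submonoid S /\ finite_set (~` S).

(* The largest integer outside N is -1, so no natural number is a Frobenius
   number of N; for S different from N, the largest integer outside S is
   a natural number. *)
Definition is_Frobenius_number (S : set nat) (F : nat) : Prop :=
  ~ S F /\ forall n, ~ S n -> n <= F.

Definition minimal_system_of_generators (S A : set nat) : Prop :=
  smallest submonoid A = S /\
  forall B, B `<` A -> smallest submonoid B <> S.

(* [msg_spec] below: the minimal system of generators exists and is unique, so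
   the default value [set0] is not used. *)
Definition msg (S : set nat) : set nat :=
  xget set0 (minimal_system_of_generators S).

(* The subtraction is not truncated, since [z <= y]. *)
Definition A_semigroup (S : set nat) : Prop :=
  numerical_semigroup S /\
  forall x y z, S x -> S y -> S z -> z <= y -> y <= x -> S (x + y - z).

Definition Arf (F : nat) : set (set nat) :=
  [set S | A_semigroup S /\ is_Frobenius_number S F].

Definition Delta (F : nat) : set nat := [set n | n = 0 \/ F + 1 <= n].

Definition Arf_set (F : nat) (X : set nat) : Prop :=
  X `&` Delta F = set0 /\ exists S, Arf F S /\ X `<=` S.

(* [smallest C X] is the intersection of the members of [C] containing [X]. *)
Definition Arf_closure (F : nat) (X : set nat) : set nat :=
  smallest (Arf F) X.

Definition Arf_system_of_generators (F : nat) (S X : set nat) : Prop :=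
  Arf_set F X /\ S = Arf_closure F X.

Definition minimal_Arf_system_of_generators (F : nat) (S X : set nat) : Prop :=
  Arf_system_of_generators F S X /\
  forall Y, Y `<` X -> S <> Arf_closure F Y.

Lemma smallest_submonoid (A : set nat) : submonoid (smallest submonoid A).
Proof.
split=> [M [[M0 _] _]|x y Ax Ay M MA]; first exact: M0.
by case: (MA) => -[_ MD] _; apply: MD; [exact: Ax | exact: Ay].
Qed.

Lemma msg_unique_existence (S : set nat) : submonoid S ->
  exists A, minimal_system_of_generators S A /\
    forall B, minimal_system_of_generators S B -> B = A.
Proof.
move=> [S0 SD].
pose A := [set x | [/\ S x, x <> 0 &
  forall y z, S y -> S z -> x = y + z -> y = 0 \/ z = 0]].
have sub_gen B : smallest submonoid B = S -> A `<=` B.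
  move=> BS x [Sx x0 xirr]; apply: contrapT => nBx.
  have : smallest submonoid B x by rewrite BS.
  move=> /(_ (S `\ x)) h.
  suff /h[_] : submonoid (S `\ x) /\ B `<=` S `\ x by apply.
  split; last first.
    move=> y By; split; last by move=> /= yx; apply: nBx; rewrite -yx.
    by rewrite -BS => M [_]; apply.
  split; first by split=> // /esym.
  move=> y z [Sy yx] [Sz zx]; split; first exact: SD.
  move=> /= e; case: (xirr y z Sy Sz (esym e)) => e0; rewrite e0 in e.
    by apply: zx; rewrite /= -e add0n.
  by apply: yx; rewrite /= -e addn0.
have genA : smallest submonoid A = S.
  apply/seteqP; split=> [x|x].
    by apply; split=> // y [].
  elim/ltn_ind: x => x IH Sx.
  have [G0 GD] := smallest_submonoid A.
  have [->//|/eqP x0] := eqVneq x 0.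
  have [Ax|nAx] := pselect (A x); first by move=> M [_]; apply.
  have [[y z] /= [Sy Sz xyz y0 z0]] : exists p, [/\ S p.1, S p.2,
      x = p.1 + p.2, p.1 <> 0 & p.2 <> 0].
    apply: contrapT => h; apply: nAx; split=> // y z Sy Sz e.
    have [->|/eqP y0] := eqVneq y 0; first by left.
    have [->|/eqP z0] := eqVneq z 0; first by right.
    by case: h; exists (y, z).
  move/eqP: y0; move/eqP: z0; rewrite -!lt0n => z0 y0.
  rewrite xyz; apply: GD; apply: IH => //; rewrite xyz.
    by rewrite -[X in X < _]addn0 ltn_add2l.
  by rewrite -[X in X < _]add0n ltn_add2r.
exists A; split.
  split=> // B [BA nAB] /sub_gen; exact: nAB.
move=> B [BS Bmin]; have AB := sub_gen _ BS.
apply/seteqP; split=> //; apply: contrapT => nBA.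
by apply: (Bmin A).
Qed.

Lemma msg_spec (S : set nat) : submonoid S ->
  minimal_system_of_generators S (msg S) /\
  forall A, minimal_system_of_generators S A -> A = msg S.
Proof.
move=> /msg_unique_existence[A [mA uA]].
have mm : minimal_system_of_generators S (msg S).
  by apply: xgetPex; exists A.
by split=> // B /uA ->; rewrite (uA _ mm).
Qed.

(* Main.v *)
Require Import Defs.
From mathcomp Require Import all_boot.
From mathcomp Require Import boolp classical_sets cardinality.

Set Implicit Arguments.
Unset Strict Implicit.
Unset Printing Implicit Defensive.

Local Open Scope classical_set_scope.

(** Call an element [x] of [S] removable when [S `\ x] is again in [Arf F].
    A removable element lies in every system of generators [Y] of [S]:
    otherwise [S `\ x] would be a member of [Arf F] containing [Y] and strictly
    smaller than [S] ([removable_in_generators]).  So it suffices that the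
    removable elements generate [S]; they are then the least system of
    generators, and a least system is the unique minimal one.

    They generate because, for [T] in [Arf F] not containing [S], the least
    element of [S `\` T] is removable ([Arf_setD1_min]): hence a [T] that
    contains all removable elements of [S] contains [S].

    Removable elements belong to [msg S] by the same principle that puts them
    in [Y], applied to submonoids instead of members of [Arf F]. *)

(** If [x] were missing from [Y], then [S `\ x] would be a member of [C]
    containing [Y] but not [S].  The family [C] is left arbitrary so as to cover
    both [Arf F] and the submonoids of the natural numbers. *)
Lemma removable_in_generators (T : Type) (C : set (set T)) (S Y : set T)
    (x : T) :
  smallest C Y = S -> S x -> C (S `\ x) -> Y x.
Proof.
move=> YS Sx D; apply: contrapT => nYx.
have subS : Y `<=` S by rewrite -YS; exact: sub_smallest.
move: (Sx); rewrite -{1}YS => /(_ (S `\ x)) h.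
suff /h[_] : C (S `\ x) /\ Y `<=` S `\ x by apply.
split=> // y Yy; split; first exact: subS.
by move=> /= yx; apply: nYx; rewrite -yx.
Qed.

(** If [x] were obtained from other elements [a], [b], [c] of [S] as [a + b]
    or [a + b - c], these would be smaller than [x], hence in [T], and then [x]
    would lie in [T] too.  Removing [x] preserves the Frobenius number because [T]
    omits [x], whence [x <= F]. *)
Lemma Arf_setD1_min (F : nat) (S T : set nat) (x : nat) :
  Arf F S -> Arf F T -> ~ T x -> (forall y, S y -> y < x -> T y) ->
  Arf F (S `\ x).
Proof.
move=> [[[[S0 SD] Sfin] SA] [SF Sgt]] [[[[T0 TD] _] TA] [_ Tgt]] nTx Tlt.
have inT a : S a -> a <> x -> a <= x -> T a.
  by move=> Sa /eqP ax lax; apply: Tlt => //; rewrite ltn_neqAle ax.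
split; first split; first split; first split.
- by split=> // x0; apply: nTx; rewrite -x0.
- move=> a b [Sa ax] [Sb bx]; split; first exact: SD.
  move=> /= e; apply: nTx; rewrite -e.
  by apply: TD; apply: inT; rewrite // -e ?leq_addr ?leq_addl.
- have -> : ~` (S `\ x) = ~` S `|` [set x] by rewrite setCD setUC.
  by rewrite finite_setU.
- move=> a b c [Sa ax] [Sb bx] [Sc cx] cb ba; split; first exact: SA.
  move=> /= e; apply: nTx; rewrite -e.
  (* [x] is [a] plus the nonnegative difference [b - c]. *)
  have lax : a <= x by rewrite -e -addnBA // leq_addr.
  have lbx := leq_trans ba lax.
  by apply: TA => //; apply: inT => //; exact: leq_trans lbx.
- split=> [[]//|n nSn].
  have [Sn|/Sgt//] := pselect (S n).
  by have [->|/eqP nx] := eqVneq n x; [exact: Tgt | case: nSn].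
Qed.

Lemma removable_generate (F : nat) (S X : set nat) :
  Arf F S -> X `<=` S -> (forall x, S x -> Arf F (S `\ x) -> X x) ->
  S = Arf_closure F X.
Proof.
move=> SArf XS remX; apply/seteqP; split; last by move=> x; apply.
(* The induction makes [x] the least element of [S] outside [T]. *)
move=> x Sx T [TArf XT]; elim/ltn_ind: x Sx => x IH Sx.
apply: contrapT => nTx; apply: (nTx); apply/XT/remX => //.
by apply: (Arf_setD1_min SArf TArf nTx) => y Sy yx; exact: IH.
Qed.

(** The set [S `\ x] still contains [0] and everything above [F]. *)
Lemma removable_not_Delta (F : nat) (S : set nat) (x : nat) :
  Arf F (S `\ x) -> ~ Delta F x.
Proof.
move=> [[[[[_ x0] _] _] _] [_ gtF]] [x_eq0|]; first by apply: x0.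
by rewrite addn1 ltnNge gtF // => -[_]; apply.
Qed.

Theorem proposition6p4 (F : nat) (S : set nat) (F_gt0 : 0 < F) (SArf : Arf F S) :
  let X := [set x | msg S x /\ Arf F (S `\ x)] in
  minimal_Arf_system_of_generators F S X /\
  forall Y : set nat, minimal_Arf_system_of_generators F S Y -> Y = X.
Proof.
move=> X.
have [[Ssub _] _] := SArf.1.
have [[msgS _] _] := msg_spec Ssub.
have XS : X `<=` S by move=> x [mx _]; rewrite -msgS; exact: sub_smallest mx.
have SX : S = Arf_closure F X.
  apply: removable_generate => // x Sx D; split=> //.
  by apply: (removable_in_generators msgS Sx); case: D => -[[]].
have Xleast Y : S = Arf_closure F Y -> X `<=` Y.
  move=> SY x Xx.
  by apply: (removable_in_generators (esym SY) (XS _ Xx)); case: Xx.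
split; first split; first split=> //; first split.
- by apply/seteqP; split=> // x [[_ /removable_not_Delta]].
- by exists S.
- by move=> Y [_ nXY] /Xleast.
move=> Y [[_ SY] Ymin]; apply/seteqP; split; last exact: Xleast.
by apply: contrapT => nYX; apply: (Ymin X) => //; split=> //; exact: Xleast.
Qed.
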